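(* Let $n,k\ge1$ be integers and let $P = \{\pm p_1, \ldots, \pm p_m\}\subseteq S^n$ and $Q=\{\pm q_1,\ldots, \pm q_m\}\subseteq S^k$ be finite antipodal sets of equal size (each consisting of $2m$ points). Let $\{\pm F_1, \ldots, \pm F_m\}$ and $\{\pm G_1,\ldots, \pm G_m\}$ be the Voronoi diagrams in $S^n$ and $S^k$ induced by $P$ and $Q$ respectively, where $\pm F_i$ is the Voronoi cell of $\pm p_i$ and $\pm G_i$ is the Voronoi cell of $\pm q_i$. Define the correspondence $R_{P,Q}\subseteq S^n\times S^k$ by $$R_{P, Q} = \{\pm (p_i, q) : 1\le i\le m \text{ and } q\in G_i\} \cup \{\pm (p, q_i) : 1\le i\le m\text{ and }p\in F_i\}.$$ Then the distortion of $R_{P, Q}$ is at most the maximum of the following four quantities: $$\operatorname{vdiam}_{S^n}(P),\qquad \pi-\operatorname{sep}_{S^n}(P),\qquad \operatorname{vdiam}_{S^k}(Q),\qquad \pi-\operatorname{sep}_{S^k}(Q).$$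
   Context: For an integer $n\ge 1$, $S^n=\{x\in\mathbb{R}^{n+1} : \langle x,x\rangle=1\}$ is the unit sphere equipped with the geodesic metric $d_{S^n}(x,x')=\arccos(\langle x,x'\rangle)$. A correspondence between sets $X$ and $Y$ is a relation $R\subseteq X\times Y$ whose coordinate projections to $X$ and to $Y$ are both surjective. For metric spaces $(X,d_X)$, $(Y,d_Y)$, its distortion is $\operatorname{dis}(R)=\sup_{(x,y),(x',y')\in R}|d_X(x,x')-d_Y(y,y')|$. A set $P\subseteq S^n$ is antipodal if $x\in P$ implies $-x\in P$. For a finite subset $P$ of a metric space $(X,d_X)$: the separation $\operatorname{sep}_X(P)$ is the minimum of $d_X(p,p')$ over distinct $p,p'\in P$; the Voronoi cell of $p\in P$ is $\{x\in X : d_X(x,p)\le d_X(x,p')\text{ for all }p'\in P\}$; the Voronoi diagram of $P$ is the collection of its Voronoi cells; and the Voronoi diameter $\operatorname{vdiam}_X(P)$ is the maximum of the diameters of the Voronoi cells of $P$. For antipodal $P\subseteq S^n$, the Voronoi cell of $-p$ is the negative of the Voronoi cell of $p$. The notation $\pm(a,b)$ means both pairs $(a,b)$ and $(-a,-b)$. *)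

(* Defs.v *)
From HB Require Import structures.
From mathcomp Require Import all_boot all_order all_algebra.
From mathcomp Require Import all_classical all_reals all_analysis.
From mathcomp Require Import ring lra.
Import Order.TTheory GRing.Theory Num.Theory.
Import numFieldNormedType.Exports.

Set Implicit Arguments.
Unset Strict Implicit.
Unset Printing Implicit Defensive.

Local Open Scope classical_set_scope.
Local Open Scope ring_scope.

Definition inner {R : realType} {d : nat} (u v : 'rV[R]_d) : R :=
  \sum_(i < d) u 0 i * v 0 i.

Section InnerTheory.
Context {R : realType} {d : nat}.
Implicit Types u v w : 'rV[R]_d.

Lemma innerC u v : inner u v = inner v u.
Proof. by apply: eq_bigr => i _; rewrite mulrC. Qed.

Lemma innerDl u v w : inner (u + v) w = inner u w + inner v w.
Proof. by rewrite -big_split; apply: eq_bigr => i _; rewrite mxE mulrDl. Qed.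

Lemma innerZl (a : R) u v : inner (a *: u) v = a * inner u v.
Proof. by rewrite /inner mulr_sumr; apply: eq_bigr => i _; rewrite mxE mulrA. Qed.

Lemma innerNl u v : inner (- u) v = - inner u v.
Proof. by rewrite -scaleN1r innerZl mulN1r. Qed.

Lemma innerDr u v w : inner u (v + w) = inner u v + inner u w.
Proof. by rewrite innerC innerDl !(innerC u). Qed.

Lemma innerZr (a : R) u v : inner u (a *: v) = a * inner u v.
Proof. by rewrite innerC innerZl innerC. Qed.

Lemma innerNr u v : inner u (- v) = - inner u v.
Proof. by rewrite innerC innerNl innerC. Qed.

Lemma inner_ge0 u : 0 <= inner u u.
Proof. by apply: sumr_ge0 => i _; rewrite -expr2 sqr_ge0. Qed.

Lemma inner_eq0 u : inner u u = 0 -> u = 0.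
Proof.
move=> /eqP; rewrite psumr_eq0; last by move=> i _; rewrite -expr2 sqr_ge0.
move=> /allP u0; apply/rowP => i; rewrite mxE; apply/eqP.
by have := u0 i (mem_index_enum i); rewrite /= mulf_eq0 orbb.
Qed.

Lemma cauchy_schwarz u v : inner u v ^+ 2 <= inner u u * inner v v.
Proof.
have [v0|v0] := eqVneq (inner v v) 0.
  by rewrite (inner_eq0 v0) -(scale0r 0) !innerZr !mul0r expr0n mulr0.
have vp : 0 < inner v v by rewrite lt_def v0 inner_ge0.
have := inner_ge0 (inner v v *: u - inner u v *: v).
rewrite !(innerDl, innerDr, innerNl, innerNr, innerZl, innerZr) (innerC v u).
set e := (X in 0 <= X); have -> : e = inner v v * (inner u u * inner v v - inner u v ^+ 2).
  by rewrite /e; ring.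
by rewrite pmulr_rge0// subr_ge0.
Qed.

End InnerTheory.

(* [sphere R n] is S^n, the unit sphere of R^(n+1). *)
Record sphere (R : realType) (n : nat) := Sphere {
  sphere_val :> 'rV[R]_n.+1;
  sphere_valP : inner sphere_val sphere_val == 1 }.

HB.instance Definition _ R n := [isSub for @sphere_val R n].
HB.instance Definition _ R n := [Choice of sphere R n by <:].

Section Sphere.
Context {R : realType} {n : nat}.
Implicit Types x y z : sphere R n.

Lemma sphere_inner x : inner x x = 1.
Proof. exact/eqP/sphere_valP. Qed.

Definition geodesic x y : R := acos (inner x y).

Lemma inner_bound x y : -1 <= inner x y <= 1.
Proof.
have := cauchy_schwarz x y.
rewrite !sphere_inner mulr1 => h; apply/andP; split; nra.
Qed.

Lemma geodesic_xx x : geodesic x x = 0.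
Proof. by rewrite /geodesic sphere_inner acos1. Qed.

Lemma geodesic_sym x y : geodesic x y = geodesic y x.
Proof. by rewrite /geodesic innerC. Qed.

Lemma geodesic_positivity x y : geodesic x y = 0 -> x = y.
Proof.
move=> /(congr1 cos); rewrite /geodesic acosK ?in_itv ?inner_bound//= cos0 => xy.
apply/val_inj/eqP; rewrite -subr_eq0; apply/eqP/inner_eq0.
rewrite !(innerDl, innerDr, innerNl, innerNr) !sphere_inner (innerC y).
by rewrite xy; ring.
Qed.

Lemma geodesic_triangle y x z : geodesic x z <= geodesic x y + geodesic y z.
Proof.
have [xy0 xypi] : 0 <= geodesic x y /\ geodesic x y <= pi.
  by rewrite acos_ge0 ?acos_lepi ?inner_bound.
have [yz0 yzpi] : 0 <= geodesic y z /\ geodesic y z <= pi.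
  by rewrite acos_ge0 ?acos_lepi ?inner_bound.
have [xz0 xzpi] : 0 <= geodesic x z /\ geodesic x z <= pi.
  by rewrite acos_ge0 ?acos_lepi ?inner_bound.
have [?|lt_pi] := leP pi (geodesic x y + geodesic y z); first exact: le_trans xzpi _.
rewrite leNgt; apply/negP => lt.
have : cos (geodesic x z) < cos (geodesic x y + geodesic y z).
  by rewrite ltr_cos ?in_itv/= ?xz0 ?addr_ge0// ltW.
have cxy : cos (geodesic x y) = inner x y.
  by rewrite acosK// in_itv/= inner_bound.
have cyz : cos (geodesic y z) = inner y z.
  by rewrite acosK// in_itv/= inner_bound.
have cxz : cos (geodesic x z) = inner x z.
  by rewrite acosK// in_itv/= inner_bound.
rewrite cosD cxz cxy cyz.
have sxy := sin2cos2 (geodesic x y); rewrite cxy in sxy.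
have syz := sin2cos2 (geodesic y z); rewrite cyz in syz.
have s1 : 0 <= sin (geodesic x y) by rewrite sin_ge0_pi// xy0.
have s2 : 0 <= sin (geodesic y z) by rewrite sin_ge0_pi// yz0.
have := cauchy_schwarz ((x : 'rV_n.+1) - inner x y *: (y : 'rV_n.+1))
                       ((z : 'rV_n.+1) - inner y z *: (y : 'rV_n.+1)).
rewrite !(innerDl, innerDr, innerNl, innerNr, innerZl, innerZr) !sphere_inner.
rewrite (innerC y x) (innerC z y).
move: sxy syz s1 s2.
move: (inner x y) (inner y z) (inner x z) (sin _) (sin _) => b c a s t.
move=> sb tc s0 t0 CS lt'.
have {}CS : (a - b * c) ^+ 2 <= (s * t) ^+ 2.
  rewrite exprMn sb tc; apply: le_trans (le_trans CS _).
    by rewrite le_eqVlt; apply/orP; left; apply/eqP; ring.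
  by rewrite le_eqVlt; apply/orP; left; apply/eqP; ring.
have : 0 <= s * t by rewrite mulr_ge0.
nra.
Qed.

HB.instance Definition _ := @isMetric.Build R (sphere R n) geodesic
  geodesic_xx geodesic_positivity geodesic_sym geodesic_triangle.

Lemma mdist_sphereE x y : mdist x y = acos (inner x y).
Proof. by []. Qed.

Lemma antipode_subproof x : inner (- (x : 'rV_n.+1)) (- (x : 'rV_n.+1)) == 1.
Proof. by rewrite innerNl innerNr opprK sphere_inner. Qed.

Definition antipode x : sphere R n := Sphere (antipode_subproof x).

Lemma antipodeK : involutive antipode.
Proof. by move=> x; apply: val_inj; rewrite /= opprK. Qed.

Lemma mdist_antipode x y : mdist (antipode x) (antipode y) = mdist x y.
Proof. by rewrite !mdist_sphereE /= innerNl innerNr opprK. Qed.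

Definition antipodal (P : set (sphere R n)) := forall x, P x -> P (antipode x).

Definition pm_set (m : nat) (p : 'I_m -> sphere R n) : set (sphere R n) :=
  [set x | exists i, x = p i \/ x = antipode (p i)].

Lemma antipodal_pm_set (m : nat) (p : 'I_m -> sphere R n) : antipodal (pm_set p).
Proof. by move=> _ [i [->|->]]; exists i; [right|left; rewrite antipodeK]. Qed.

End Sphere.

(* The quantities below are taken in the extended reals, where every supremum
   and infimum exists; over a nonempty finite family they are a maximum and a minimum. *)
Section MetricNotions.
Local Open Scope ereal_scope.
Context {R : realType}.

Definition correspondence {X Y : Type} (C : set (X * Y)) :=
  fst @` C = [set: X] /\ snd @` C = [set: Y].

Definition distortion {X Y : metricType R} (C : set (X * Y)) : \bar R :=
  ereal_sup [set (`|mdist a.1 b.1 - mdist a.2 b.2|)%R%:E | a in C & b in C].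

Definition diameter {X : metricType R} (A : set X) : \bar R :=
  ereal_sup [set (mdist x y)%:E | x in A & y in A].

Definition separation {X : metricType R} (P : set X) : \bar R :=
  ereal_inf [set (mdist a.1 a.2)%:E | a in [set a | [/\ P a.1, P a.2 & a.1 <> a.2]]].

Definition voronoi_cell {X : metricType R} (P : set X) (p : X) : set X :=
  [set x | forall p', P p' -> (mdist x p <= mdist x p')%R].

Definition vdiam {X : metricType R} (P : set X) : \bar R :=
  ereal_sup [set diameter (voronoi_cell P p) | p in P].

End MetricNotions.

Section VoronoiCorrespondence.
Context {R : realType} {n k m : nat}.
Implicit Types (p : 'I_m -> sphere R n) (q : 'I_m -> sphere R k).

Definition pm_pair (x : sphere R n) (y : sphere R k) :
    set (sphere R n * sphere R k) :=
  [set (x, y); (antipode x, antipode y)].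

Definition voronoi_correspondence p q : set (sphere R n * sphere R k) :=
  (\bigcup_i \bigcup_(y in voronoi_cell (pm_set q) (q i)) pm_pair (p i) y) `|`
  (\bigcup_i \bigcup_(x in voronoi_cell (pm_set p) (p i)) pm_pair x (q i)).

End VoronoiCorrespondence.

Lemma voronoi_cell_antipode {R : realType} {n : nat} (P : set (sphere R n)) p :
  antipodal P ->
  voronoi_cell P (antipode p) = antipode @` voronoi_cell P p.
Proof.
move=> aP; apply/seteqP; split => [x xp|_ [x xp <-] p' Pp'].
  exists (antipode x); last by rewrite antipodeK.
  move=> p' /aP/xp; rewrite -mdist_antipode antipodeK => /le_trans; apply.
  by rewrite -mdist_antipode antipodeK.
rewrite mdist_antipode (le_trans (xp _ (aP _ Pp')))//.
by rewrite -mdist_antipode antipodeK.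
Qed.

Lemma voronoi_cover {R : realType} {n m : nat} (p : 'I_m -> sphere R n)
    (x : sphere R n) : (0 < m)%N ->
  exists i, voronoi_cell (pm_set p) (p i) x \/
            voronoi_cell (pm_set p) (p i) (antipode x).
Proof.
move=> m0; pose f (s : bool * 'I_m) := mdist (if s.1 then antipode x else x) (p s.2).
have [s0 _ s0min] := @arg_minP _ _ _ (false, Ordinal m0) xpredT f isT.
have cell : voronoi_cell (pm_set p) (p s0.2) (if s0.1 then antipode x else x).
  move=> _ [j [->|->]]; first by have := s0min (s0.1, j) isT.
  have := s0min (~~ s0.1, j) isT; rewrite /f /= => /le_trans; apply.
  by case: s0.1; rewrite /= -mdist_antipode ?antipodeK.
by exists s0.2; move: cell; case: s0.1; [right|left].
Qed.

Lemma voronoi_correspondenceP {R : realType} {n k m : nat}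
    (p : 'I_m -> sphere R n) (q : 'I_m -> sphere R k) :
  (0 < m)%N -> correspondence (voronoi_correspondence p q).
Proof.
move=> m0; split; apply/seteqP; split => // z _.
- have [i [zi|zi]] := voronoi_cover p z m0.
    by exists (z, q i) => //; right; exists i => //; exists z => //; left.
  exists (z, antipode (q i)) => //; right; exists i => //.
  by exists (antipode z) => //; right; rewrite antipodeK.
- have [i [zi|zi]] := voronoi_cover q z m0.
    by exists (p i, z) => //; left; exists i => //; exists z => //; left.
  exists (antipode (p i), z) => //; left; exists i => //.
  by exists (antipode z) => //; right; rewrite antipodeK.
Qed.

(* Main.v *)
Require Import Defs.
From mathcomp Require Import all_boot all_order all_algebra finmap.
From mathcomp Require Import all_classical all_reals all_analysis.
From mathcomp Require Import lra.

(** Index the points of P and Q by signed indices s = (sign, i), so that an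
    element (x, y) of R_{P,Q} lies in F_s x G_s for some s and one of x, y is
    the centre of its cell. For elements with indices s and t:
    - if s = t, both distances are at most the Voronoi diameters;
    - if s = -t, negating one of the two elements turns both distances d into
      pi - d and reduces to s = t;
    - otherwise p_s is distinct from p_t and -p_t, and likewise for q. If the
      first coordinates are the centres p_s, p_t, their distance lies in
      [sep P, pi - sep P], hence within pi - sep P of any number of [0, pi].
      If one has (p_s, y) and (x, q_t), the Voronoi property puts d(p_s, x) in
      [sep P / 2, pi - sep P / 2] and d(y, q_t) in [sep Q / 2, pi - sep Q / 2],
      so that they differ by at most pi - (sep P + sep Q) / 2. *)

Set Implicit Arguments.
Unset Strict Implicit.
Unset Printing Implicit Defensive.

Import Order.TTheory GRing.Theory Num.Theory.

Local Open Scope classical_set_scope.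
Local Open Scope ring_scope.

Section SphereDistance.
Context {R : realType} {n : nat}.
Implicit Types (x y c : sphere R n) (P : set (sphere R n)).

Lemma sphere_mdist_bound x y : 0 <= mdist x y <= pi.
Proof. by rewrite mdist_sphereE acos_ge0 ?acos_lepi ?inner_bound. Qed.

Lemma mdist_antipoder x y : mdist x (antipode y) = pi - mdist x y.
Proof. by rewrite !mdist_sphereE /= innerNr acosN// inner_bound. Qed.

Lemma voronoi_cell_center P c : voronoi_cell P c c.
Proof.
move=> y _; have -> : mdist c c = 0 by exact: geodesic_xx.
by have /andP[] := sphere_mdist_bound c y.
Qed.

(** Triangle inequality through [x], which is no farther from [c] than from [c']. Used for [c'] and
    for its antipode, it bounds the distance from [x] to [c'] on both sides. *)
Lemma voronoi_cell_far P c c' x :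
  P c' -> voronoi_cell P c x -> mdist c c' <= 2 * mdist x c'.
Proof.
move=> Pc' /(_ _ Pc') xc.
have : mdist c c' <= mdist c x + mdist x c' by exact: geodesic_triangle.
have -> : mdist c x = mdist x c by exact: geodesic_sym.
lra.
Qed.

(** A purely real form of the two bounds on [P], to which linear arithmetic applies. *)
Definition controlled P (M : R) :=
  (forall c x y, P c -> voronoi_cell P c x -> voronoi_cell P c y ->
     mdist x y <= M) /\
  (forall a b, P a -> P b -> a <> b -> pi - mdist a b <= M).

Lemma mdist_le_vdiam P c x y : P c -> voronoi_cell P c x ->
  voronoi_cell P c y -> ((mdist x y)%:E <= vdiam P)%E.
Proof.
move=> Pc xc yc; apply: (@le_trans _ _ (diameter (voronoi_cell P c))).
  by apply: ereal_sup_ubound; exists x => //; exists y.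
by apply: ereal_sup_ubound; exists c.
Qed.

Lemma controlledP P (M : R) : (vdiam P <= M%:E)%E ->
  (pi%:E - separation P <= M%:E)%E -> controlled P M.
Proof.
move=> vM sM; split=> [c x y Pc xc yc|a b Pa Pb ab].
  by rewrite -lee_fin (le_trans _ vM)// (mdist_le_vdiam Pc).
rewrite -lee_fin (le_trans _ sM)// EFinB leeB//.
by apply: ereal_inf_lbound; exists (a, b).
Qed.

End SphereDistance.

Section SignedFamily.
Context {R : realType} {n m : nat}.
Implicit Types (p : 'I_m -> sphere R n) (s : bool * 'I_m).

Definition signed p s : sphere R n :=
  if s.1 then antipode (p s.2) else p s.2.

Definition flip s : bool * 'I_m := (~~ s.1, s.2).

Lemma signed_flip p s : signed p (flip s) = antipode (signed p s).
Proof. by case: s => -[] i; rewrite /signed/= ?antipodeK. Qed.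

Lemma signed_pm_set p s : pm_set p (signed p s).
Proof. by case: s => -[] i; exists i; [right|left]. Qed.

(** The list of the [2 * m] signed points enumerates a set of [2 * m] elements, so it has no
    repetition. *)
Lemma signed_inj p : (pm_set p #= `I_(2 * m)%N)%card -> injective (signed p).
Proof.
pose l := map (signed p) (enum {: bool * 'I_m}).
have -> : pm_set p = [set` [fset z in l]%fset].
  apply/seteqP; split=> z /=; rewrite inE.
    case=> i [->|->]; apply/mapP.
      by exists (false, i); rewrite ?mem_enum.
    by exists (true, i); rewrite ?mem_enum.
  by case/mapP=> s _ ->; exact: signed_pm_set.
move=> /card_eq_fsetP cardl.
have ul : uniq l.
  apply: (@leq_size_uniq _ (enum_fset [fset z in l]%fset)).
  - exact: fset_uniq.
  - by move=> z; rewrite inE.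
  - by rewrite cardl size_map -cardE card_prod card_bool card_ord.
move=> s t st; move/injectiveP : ul; exact.
Qed.

End SignedFamily.

Lemma voronoi_correspondence_signed {R : realType} {n k m : nat}
    (p : 'I_m -> sphere R n) (q : 'I_m -> sphere R k) z :
  voronoi_correspondence p q z -> exists s,
    [/\ voronoi_cell (pm_set p) (signed p s) z.1,
        voronoi_cell (pm_set q) (signed q s) z.2
      & z.1 = signed p s \/ z.2 = signed q s].
Proof.
have cellN d (r : 'I_m -> sphere R d) i x : voronoi_cell (pm_set r) (r i) x ->
    voronoi_cell (pm_set r) (antipode (r i)) (antipode x).
  by rewrite (voronoi_cell_antipode _ (@antipodal_pm_set _ _ _ r)) => xi; exists x.
case=> -[i _ [x xi [->|->]]].
- by exists (false, i); split => //=; [exact: voronoi_cell_center|left].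
- exists (true, i); split => /=; [exact: voronoi_cell_center| |by left].
  exact: cellN.
- by exists (false, i); split => //=; [exact: voronoi_cell_center|right].
- exists (true, i); split => /=; [|exact: voronoi_cell_center|by right].
  exact: cellN.
Qed.

Section PairDistortion.
Context {R : realType} {n k : nat}.
Context (P : set (sphere R n)) (Q : set (sphere R k)) (M : R).
Context (cP : controlled P M) (cQ : controlled Q M).

Lemma distortion_same_cell a b x x' y y' : P a -> Q b ->
  voronoi_cell P a x -> voronoi_cell P a x' ->
  voronoi_cell Q b y -> voronoi_cell Q b y' ->
  `|mdist x x' - mdist y y'| <= M.
Proof.
move=> Pa Qb xa x'a yb y'b; rewrite ler_norml.
have := cP.1 _ _ _ Pa xa x'a; have := cQ.1 _ _ _ Qb yb y'b.
have := sphere_mdist_bound x x'; have := sphere_mdist_bound y y'.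
lra.
Qed.

(** The separation bounds for [a'] and its antipode put d(a, a') in [pi - M, M], so it is within [M]
    of every number in [0, pi]; [y] and [y'] can be arbitrary. *)
Lemma distortion_centers a a' (y y' : sphere R k) :
  antipodal P -> P a -> P a' -> a <> a' -> a <> antipode a' ->
  `|mdist a a' - mdist y y'| <= M.
Proof.
move=> aP Pa Pa' aa' aNa'; rewrite ler_norml.
have := cP.2 _ _ Pa Pa' aa'; have := cP.2 _ _ Pa (aP _ Pa') aNa'.
rewrite mdist_antipoder.
have := sphere_mdist_bound a a'; have := sphere_mdist_bound y y'.
lra.
Qed.

(** Both distances lie in [(pi - M) / 2, (pi + M) / 2], an interval of length [M]. *)
Lemma distortion_mixed a a' b b' x y : antipodal P -> antipodal Q ->
  P a -> P a' -> Q b -> Q b' ->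
  a <> a' -> a <> antipode a' -> b <> b' -> b <> antipode b' ->
  voronoi_cell P a x -> voronoi_cell Q b' y ->
  `|mdist x a' - mdist b y| <= M.
Proof.
move=> aP aQ Pa Pa' Qb Qb' aa' aNa' bb' bNb' xa yb'.
have -> : mdist b y = mdist y b by exact: geodesic_sym.
rewrite ler_norml.
have := cP.2 _ _ Pa Pa' aa'; have := cP.2 _ _ Pa (aP _ Pa') aNa'.
have := cQ.2 _ _ Qb Qb' bb'; have := cQ.2 _ _ Qb (aQ _ Qb') bNb'.
have := voronoi_cell_far Pa' xa; have := voronoi_cell_far (aP _ Pa') xa.
have := voronoi_cell_far Qb yb'; have := voronoi_cell_far (aQ _ Qb) yb'.
rewrite !mdist_antipoder.
have -> : mdist b' b = mdist b b' by exact: geodesic_sym.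
lra.
Qed.

End PairDistortion.

Lemma voronoi_correspondence_distortion {R : realType} {n k m : nat}
    (p : 'I_m -> sphere R n) (q : 'I_m -> sphere R k) (M : R) :
  injective (signed p) -> injective (signed q) ->
  controlled (pm_set p) M -> controlled (pm_set q) M ->
  forall z w, voronoi_correspondence p q z -> voronoi_correspondence p q w ->
  `|mdist z.1 w.1 - mdist z.2 w.2| <= M.
Proof.
move=> pI qI cP cQ [x y] [x' y'] /voronoi_correspondence_signed[s [/= xs ys cz]].
move=> /voronoi_correspondence_signed[t [/= xt yt cw]].
have Ps u := signed_pm_set p u; have Qs u := signed_pm_set q u.
have aP := @antipodal_pm_set _ _ _ p; have aQ := @antipodal_pm_set _ _ _ q.
have [st|/eqP st] := eqVneq s t.
  by subst t; exact: (distortion_same_cell cP cQ (Ps s) (Qs s)).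
have [sNt|/eqP sNt] := eqVneq s (flip t).
  have -> : mdist x x' - mdist y y' =
      mdist y (antipode y') - mdist x (antipode x').
    by rewrite !mdist_antipoder; lra.
  rewrite distrC; apply: (distortion_same_cell cP cQ (Ps s) (Qs s)) => //.
    rewrite sNt signed_flip voronoi_cell_antipode//; exists x'.
  by rewrite sNt signed_flip voronoi_cell_antipode//; exists y'.
(* The mixed case is also used with [s] and [t] exchanged. *)
have [tNs ts] : t <> flip s /\ t <> s.
  split=> [tE|/esym//]; apply: sNt; rewrite tE /flip/= negbK.
  by case: (s).
have neq d (r : 'I_m -> sphere R d) u v : injective (signed r) ->
    u <> v -> signed r u <> signed r v by move=> rI uv /rI.
have neqN d (r : 'I_m -> sphere R d) u v : injective (signed r) ->
    u <> flip v -> signed r u <> antipode (signed r v).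
  by move=> rI uv; rewrite -signed_flip => /rI.
case: cz cw => -> [] ->.
- apply: (distortion_centers cP) => //; [exact: neq|exact: neqN].
(* Here the centres are [x] and [y']; symmetry of both distances gives the mixed case with [t]
   before [s]. *)
- rewrite [mdist (signed p s) x']geodesic_sym [mdist y _]geodesic_sym.
  by apply: (distortion_mixed cP cQ aP aQ (Ps t) (Ps s) (Qs t) (Qs s)) => //;
    first [exact: neq|exact: neqN].
- by apply: (distortion_mixed cP cQ aP aQ (Ps s) (Ps t) (Qs s) (Qs t)) => //;
    first [exact: neq|exact: neqN].
- rewrite distrC; apply: (distortion_centers cQ) => //; [exact: neq|exact: neqN].
Qed.

Local Open Scope ereal_scope.

Theorem theorem3p1 (R : realType) (n k m : nat)
    (hn : (0 < n)%N) (hk : (0 < k)%N) (hm : (0 < m)%N)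
    (p : 'I_m -> sphere R n) (q : 'I_m -> sphere R k)
    (hP : (pm_set p #= `I_(2 * m)%N)%card)
    (hQ : (pm_set q #= `I_(2 * m)%N)%card) :
  distortion (voronoi_correspondence p q) <=
    maxe (maxe (vdiam (pm_set p)) (pi%:E - separation (pm_set p)))
         (maxe (vdiam (pm_set q)) (pi%:E - separation (pm_set q))).
Proof.
set M := (X in _ <= X).
have [vP sP vQ sQ] : [/\ vdiam (pm_set p) <= M,
    pi%:E - separation (pm_set p) <= M, vdiam (pm_set q) <= M &
    pi%:E - separation (pm_set q) <= M].
  by split; rewrite /M !le_max lexx ?orbT.
(* A cell contains its centre, so [M] is at least a real number: this rules out [-oo] below. *)
pose c := signed p (false, Ordinal hm).
have cM : (mdist c c)%:E <= M.
  apply: le_trans vP; apply: (@mdist_le_vdiam _ _ _ c).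
  - exact: signed_pm_set.
  - exact: voronoi_cell_center.
  - exact: voronoi_cell_center.
clearbody M; case: M vP sP vQ sQ cM => [M vP sP vQ sQ _|*|//].
  apply: ge_ereal_sup => _ [z zC [w wC <-]]; rewrite lee_fin.
  apply: (voronoi_correspondence_distortion (signed_inj hP) (signed_inj hQ)) => //.
    exact: controlledP.
  exact: controlledP.
exact: leey.
Qed.
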